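(* Let $\mathcal X\subseteq\mathbb R^{D_x}$ be compact with $\sup_{x\in\mathcal X}\|x\|\le R_x$. Suppose there is a nondecreasing function $\varepsilon:\mathbb R_+\to\mathbb R_+$ of at most polynomial growth such that for every fixed $z\in\mathcal X$ and every $\delta\in(0,1)$, with probability at least $1-\delta$, $$\mathbb E_{\mathbb P^\star}[\ell(z,\xi)]-\mathbb E_{\hat{\mathbb P}_N}[\ell(z,\xi)]\le\frac1{\sqrt N}\,\varepsilon\!\left(\log\frac1\delta\right).$$ Let $L=\max_{j\in[J]}\|\mathbf A_j\|_{\mathrm{op}}\sqrt\Omega+\max_{j\in[J]}\|\mathbf b_j\|$, let $\delta\in(0,1)$, and set $$\epsilon=\frac1{\sqrt N}\left(\varepsilon\!\left(D_x\log\big(1+2R_xL\sqrt N\big)+\log\frac1\delta\right)+2\right).$$ Let $\hat J=\min_{x\in\mathcal X}\sup_{\mathbb Q\in\mathcal P_\epsilon}\mathbb E_{\mathbb Q}[\ell(x,\xi)]$ and let $\hat x$ be a minimizer of this problem. Then, with probability at least $1-\delta$, $$\mathbb E_{\mathbb P^\star}[\ell(\hat x,\xi)]\le\hat J.$$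
   Context: The decision set $\mathcal X\subseteq\mathbb R^{D_x}$ is compact and convex, and $\Xi\subseteq\mathbb R^{D_\xi}$ is the support set of the random vector $\xi$; $\mathscr P(\Xi)$ is the set of probability distributions on $\Xi$. The loss is $\ell(x,\xi)=\max_{j\in[J]}\big(a_j(x)^\top\xi+b_j(x)\big)$ with $a_j(x)=\mathbf A_jx+\bar{\mathbf a}_j$ and $b_j(x)=\mathbf b_j^\top x+\bar b_j$, and $c_1,c_2\ge 0$ satisfy $|\ell(x,\xi)|\le c_1+c_2\|\xi\|$ for all $x\in\mathcal X$, $\xi\in\Xi$. $\mathbb P^\star$ is the true distribution; $\hat{\mathbb P}_N$ is a reference distribution on $\Xi$ constructed from $N$ random data points, and ''with probability'' refers to the randomness of the data. The constant $\Omega$ satisfies $\mathbb E_{\hat{\mathbb P}_N}[\|\xi\|^2]<\Omega$ and $\mathbb E_{\mathbb P^\star}[\|\xi\|^2]\le\Omega$. $\mathbb Z$ is a probability distribution with full support on $\mathcal X$, $[u]_+=\max\{u,0\}$, and $$\mathcal P_\epsilon=\Big\{\mathbb Q\in\mathscr P(\Xi):\ \mathbb E_{z\sim\mathbb Z}\big[\big[\mathbb E_{\mathbb Q}[\ell(z,\xi)]-\mathbb E_{\hat{\mathbb P}_N}[\ell(z,\xi)]-\epsilon\big]_+\big]\le 0,\ \mathbb E_{\mathbb Q}[\|\xi\|^2]\le\Omega\Big\}.$$ $\|\cdot\|$ is the Euclidean norm and $\|\cdot\|_{\mathrm{op}}$ the operator norm. The outer minimum is attained. *)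

(* Defs.v *)
From HB Require Import structures.
From mathcomp Require Import all_boot all_order all_algebra.
From mathcomp Require Import all_classical all_reals all_analysis.

Set Implicit Arguments.
Unset Strict Implicit.
Unset Printing Implicit Defensive.

Import Order.TTheory GRing.Theory Num.Theory.
Import numFieldNormedType.Exports.

Local Open Scope classical_set_scope.
Local Open Scope ring_scope.

(* R^n is the type of column vectors.  The library's topology on it is the
   usual one, but the library's norm on matrices is the sup norm. *)

Notation borel R n := (g_sigma_algebraType (@open 'cV[R]_n)).

Section Euclidean.
Context {R : realType}.

Definition dot n (u v : 'cV[R]_n) : R := (u^T *m v) 0 0.

Definition enorm n (u : 'cV[R]_n) : R := Num.sqrt (dot u u).

Definition opnorm m n (A : 'M[R]_(m, n)) : R :=
  sup [set enorm (A *m u) | u in [set u : 'cV[R]_n | enorm u <= 1]].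

(* The number of indices is J.+1, so the maximum is over a nonempty set. *)
Definition maxI J (f : 'I_J.+1 -> R) : R := \big[Num.max/f ord0]_(j < J.+1) f j.

Definition loss Dx Dxi J (A : 'I_J.+1 -> 'M[R]_(Dxi, Dx))
    (abar : 'I_J.+1 -> 'cV[R]_Dxi) (b : 'I_J.+1 -> 'cV[R]_Dx)
    (bbar : 'I_J.+1 -> R) (x : 'cV[R]_Dx) (xi : 'cV[R]_Dxi) : R :=
  maxI (fun j => dot (A j *m x + abar j) xi + (dot (b j) x + bbar j)).

End Euclidean.

Section Probability.
Context {R : realType}.

(* Distributions on S are Borel probabilities on R^n carried by S. *)
Definition distribution_on n (S : set (borel R n))
    (Q : probability (borel R n) R) : Prop := Q S = 1%E.

Definition full_support_on n (S : set 'cV[R]_n)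
    (Q : probability (borel R n) R) : Prop :=
  distribution_on S Q /\
  forall U : set 'cV[R]_n, open U -> U `&` S !=set0 -> (0 < Q U)%E.

(* E need not be measurable: "E holds with probability at least p" is read as
   the inner probability of E, i.e. P E >= p whenever E is measurable. *)
Definition with_probability_at_least d (T : measurableType d)
    (P : probability T R) (p : R) (E : set T) : Prop :=
  exists B : set T, [/\ measurable B, B `<=` E & (p%:E <= P B)%E].

End Probability.

Section DRO.
Context {R : realType} (Dx Dxi : nat).
Local Open Scope ereal_scope.

(* Both requirements are conjoined, so the expectations of the loss are only
   relevant for Q with a finite second moment, where they are finite. *)
Definition ambiguity_set (X : set 'cV[R]_Dx) (Xi : set 'cV[R]_Dxi)
    (ell : 'cV[R]_Dx -> 'cV[R]_Dxi -> R) (Z : probability (borel R Dx) R)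
    (Omega : R) (Phat : probability (borel R Dxi) R) (e : R) :
    set (probability (borel R Dxi) R) :=
  [set Q | [/\ distribution_on Xi Q,
     \int[Z]_(z in X) maxe ('E_Q[ell z] - 'E_Phat[ell z] - e%:E) 0 <= 0
   & 'E_Q[fun xi => (enorm xi ^+ 2)%R] <= Omega%:E]].

Definition worst_case (ell : 'cV[R]_Dx -> 'cV[R]_Dxi -> R)
    (A : set (probability (borel R Dxi) R)) (x : 'cV[R]_Dx) : \bar R :=
  ereal_sup [set 'E_Q[ell x] | Q in A].

Definition is_minimizer (X : set 'cV[R]_Dx) (f : 'cV[R]_Dx -> \bar R)
    (x : 'cV[R]_Dx) : Prop :=
  X x /\ forall y, X y -> f x <= f y.

End DRO.

(* Main.v *)
Require Import Defs.
From HB Require Import structures.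
From mathcomp Require Import all_boot all_order all_algebra.
From mathcomp Require Import all_classical all_reals all_analysis.
From mathcomp Require Import measurable_realfun ring lra.

Set Implicit Arguments.
Unset Strict Implicit.
Unset Printing Implicit Defensive.

Import Order.TTheory GRing.Theory Num.Theory.
Import numFieldNormedType.Exports.

Local Open Scope classical_set_scope.
Local Open Scope ring_scope.

(** The ambiguity set is built from the gap between the two expected losses, so
the theorem reduces to one event: the gap
['E_Pstar[ell x] - 'E_Phat[ell x]] is at most the radius [e] for all [x] in [X]
simultaneously.  On that event [Pstar] itself lies in the ambiguity set, and its
expected loss at the minimizer is at most the worst case there, which is the
optimal value ([expectation_le_worst_case]).

The hypothesis controls the gap at one decision at a time.  It becomes uniform
through a finite net of [X] at scale [1 / (L * sqrt N)].  The failure probability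
[delta] is shared evenly among the net points ([union_bound]); this adds the
logarithm of the number of points to the argument of [eps].  Between net points
the expected losses are [L]-Lipschitz, uniformly over all distributions with
second moment at most [Omega] ([expectation_loss_lipschitz]), so that moving to
the nearest net point changes each of the two expectations by at most
[1 / sqrt N]; this is the [2] in the radius ([gap_of_nearby_gap]).

The constants leave no room for a crude net: at most [(1 + 2 r / e) ^ n] points
are allowed at scale [e] in a ball of radius [r].  A largest [e]-separated family
is a net ([exists_net]), and the usual proof of the bound compares the volumes of
the disjoint balls of radius [e / 2] around its points with that of the ball of
radius [r + e / 2].  Here no [n]-dimensional volume is used.  The configuration of
small balls in the large ball is nested in itself [t] times
([separated_iterate]), the number of points of the nested family is bounded by
counting grid cells ([separated_card_grid]), which loses only a factor that does
not depend on [t], and this factor disappears as [t] grows ([separated_card]). *)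

(** * Euclidean geometry of column vectors *)

Section EuclideanGeometry.
Context {R : realType}.
Implicit Types n m : nat.

Lemma dotE n (u v : 'cV[R]_n) : dot u v = \sum_i u i 0 * v i 0.
Proof. by rewrite /dot mxE; apply: eq_bigr => i _; rewrite mxE. Qed.

Lemma dotC n (u v : 'cV[R]_n) : dot u v = dot v u.
Proof. by rewrite !dotE; apply: eq_bigr => i _; rewrite mulrC. Qed.

Lemma dotDl n (u v w : 'cV[R]_n) : dot (u + v) w = dot u w + dot v w.
Proof. by rewrite /dot linearD mulmxDl mxE. Qed.

Lemma dotZl n a (u v : 'cV[R]_n) : dot (a *: u) v = a * dot u v.
Proof. by rewrite /dot linearZ -scalemxAl mxE. Qed.

Lemma dotDr n (u v w : 'cV[R]_n) : dot u (v + w) = dot u v + dot u w.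
Proof. by rewrite /dot mulmxDr mxE. Qed.

Lemma dotZr n a (u v : 'cV[R]_n) : dot u (a *: v) = a * dot u v.
Proof. by rewrite /dot -scalemxAr mxE. Qed.

Lemma dot_ge0 n (u : 'cV[R]_n) : 0 <= dot u u.
Proof. by rewrite dotE sumr_ge0// => i _; rewrite -expr2 sqr_ge0. Qed.

Lemma enorm_ge0 n (u : 'cV[R]_n) : 0 <= enorm u.
Proof. exact: sqrtr_ge0. Qed.

Lemma enorm_sqr n (u : 'cV[R]_n) : enorm u ^+ 2 = dot u u.
Proof. by rewrite sqr_sqrtr// dot_ge0. Qed.

Lemma enormZ n a (u : 'cV[R]_n) : enorm (a *: u) = `|a| * enorm u.
Proof.
by rewrite /enorm dotZl dotZr mulrA -expr2 sqrtrM ?sqr_ge0// sqrtr_sqr.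
Qed.

Lemma enormN n (u : 'cV[R]_n) : enorm (- u) = enorm u.
Proof. by rewrite -scaleN1r enormZ normrN1 mul1r. Qed.

Lemma enorm0 n : enorm (0 : 'cV[R]_n) = 0.
Proof. by rewrite -(scale0r (0 : 'cV[R]_n)) enormZ normr0 mul0r. Qed.

Lemma enormB n (u v : 'cV[R]_n) : enorm (u - v) = enorm (v - u).
Proof. by rewrite -enormN opprB. Qed.

Lemma coord_le_enorm n (u : 'cV[R]_n) i : `|u i 0| <= enorm u.
Proof.
rewrite -sqrtr_sqr ler_sqrt ?dot_ge0// dotE (bigD1 i)//= -expr2 lerDl.
by rewrite sumr_ge0// => j _; rewrite -expr2 sqr_ge0.
Qed.

Lemma enorm_eq0 n (u : 'cV[R]_n) : enorm u = 0 -> u = 0.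
Proof.
move=> u0; apply/matrixP => i j; rewrite (ord1 j) mxE.
by apply/eqP; rewrite -normr_le0 -u0 coord_le_enorm.
Qed.

Lemma cauchy_schwarz n (u v : 'cV[R]_n) : dot u v <= enorm u * enorm v.
Proof.
have [/enorm_eq0 ->|u0] := eqVneq (enorm u) 0.
  by rewrite enorm0 mul0r -(scale0r (0 : 'cV[R]_n)) dotZl mul0r.
have [/enorm_eq0 ->|v0] := eqVneq (enorm v) 0.
  by rewrite enorm0 mulr0 -(scale0r (0 : 'cV[R]_n)) dotZr mul0r.
have a0 : 0 < enorm u by rewrite lt_neqAle eq_sym u0 enorm_ge0.
have b0 : 0 < enorm v by rewrite lt_neqAle eq_sym v0 enorm_ge0.
have := dot_ge0 (enorm v *: u - enorm u *: v).
rewrite -scaleNr !(dotDl, dotDr, dotZl, dotZr) (dotC v u) -!enorm_sqr.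
set a := enorm u in a0 *; set b := enorm v in b0 *; set p := dot u v => h.
rewrite -subr_ge0 -(pmulr_rge0 _ (mulr_gt0 a0 b0)).
by rewrite -(pmulr_rge0 _ (ltr0Sn R 1)); apply: le_trans h _; rewrite le_eqVlt;
  apply/orP; left; apply/eqP; ring.
Qed.

Lemma enormD n (u v : 'cV[R]_n) : enorm (u + v) <= enorm u + enorm v.
Proof.
rewrite -(ler_pXn2r (ltn0Sn 1)) ?nnegrE ?addr_ge0 ?enorm_ge0//.
rewrite enorm_sqr !(dotDl, dotDr) (dotC v u) sqrrD -!enorm_sqr.
have := cauchy_schwarz u v; lra.
Qed.

Lemma enorm_le_sum n (u : 'cV[R]_n) : enorm u <= \sum_i `|u i 0|.
Proof.
have S0 : 0 <= \sum_i `|u i 0| by exact: sumr_ge0.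
rewrite -(ler_pXn2r (ltn0Sn 1)) ?nnegrE ?enorm_ge0// enorm_sqr dotE expr2 mulr_suml.
apply: ler_sum => i _; apply: le_trans (ler_norm _) _; rewrite normrM.
by rewrite ler_wpM2l// (bigD1 i)//= lerDl sumr_ge0.
Qed.

Lemma le_maxI J (f : 'I_J.+1 -> R) j : f j <= maxI f.
Proof. exact: le_bigmax. Qed.

Lemma maxI_le J (f : 'I_J.+1 -> R) c : (forall j, f j <= c) -> maxI f <= c.
Proof. by move=> fc; apply: bigmax_le. Qed.

Lemma enorm_mulmx_le_opnorm m n (M : 'M[R]_(m, n)) (u : 'cV[R]_n) :
  enorm (M *m u) <= opnorm M * enorm u.
Proof.
have [/enorm_eq0 ->|u0] := eqVneq (enorm u) 0; first by rewrite mulmx0 !enorm0 mulr0.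
have b0 : 0 < enorm u by rewrite lt_neqAle eq_sym u0 enorm_ge0.
rewrite -ler_pdivrMr// mulrC -{1}(gtr0_norm b0) -normfV -enormZ scalemxAr.
apply: ub_le_sup; last first.
  by exists ((enorm u)^-1 *: u) => //=; rewrite enormZ normfV gtr0_norm// mulVf.
(* A supremum bounds its set only if some bound exists; the entries give one. *)
exists (\sum_i \sum_j `|M i j|) => _ [v /= v1 <-].
apply: le_trans (enorm_le_sum _) _; apply: ler_sum => i _; rewrite mxE.
apply: le_trans (ler_norm_sum _ _ _) _; apply: ler_sum => j _.
by rewrite normrM ler_piMr// (le_trans (coord_le_enorm _ _)).
Qed.

Lemma opnorm_ge0 m n (M : 'M[R]_(m, n)) : 0 <= opnorm M.
Proof.
rewrite /opnorm; set S := [set _ | _ in _].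
have [supS|/sup_out ->//] := pselect (has_sup S).
apply: ub_le_sup; first by case: supS.
by exists 0; rewrite /= ?mulmx0 enorm0.
Qed.

End EuclideanGeometry.

(** * Packing and covering numbers of Euclidean balls *)

Section Packing.
Context {R : realType}.
Implicit Types n : nat.

Definition separated n (I : eqType) (e : R) (f : I -> 'cV[R]_n) :=
  forall i j, i != j -> e <= enorm (f i - f j).

(** Cutting the cube [[-M, M]^n] into cells of side [s] puts at most one point
of the family in each cell, because two points of a cell are at distance at most
[n s].  The resulting bound has the right exponent but a constant that depends
on [n]. *)
Lemma separated_card_grid n (I : finType) (f : I -> 'cV[R]_n) (M s : R) :
  0 <= M -> 0 < s -> (forall i, enorm (f i) <= M) ->
  separated (n.+1%:R * s) f -> #|I|%:R <= (2 * M / s + 1) ^+ n.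
Proof.
move=> M0 s0 fM sep; set m := Num.truncn (2 * M / s).
have cge0 i k : 0 <= (f i k 0 + M) / s.
  rewrite divr_ge0 ?(ltW s0)//; have := le_trans (coord_le_enorm (f i) k) (fM i).
  by rewrite ler_norml => /andP[? _]; lra.
pose cell i : {ffun 'I_n -> 'I_m.+1} :=
  [ffun k => inord (Num.truncn ((f i k 0 + M) / s))].
have cellE i k : cell i k = Num.truncn ((f i k 0 + M) / s) :> nat.
  rewrite ffunE inordK// ltnS le_truncn// ler_pM2r ?invr_gt0//.
  have := le_trans (coord_le_enorm (f i) k) (fM i).
  by rewrite ler_norml => /andP[_ ?]; lra.
have cell_inj : injective cell.
  move=> i j cij; apply/eqP/negPn/negP => /sep; apply/negP; rewrite -ltNge.
  have diff k : `|(f i - f j) k 0| <= s.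
    have := congr1 (fun c : {ffun _} => nat_of_ord (c k)) cij; rewrite /= !cellE => tij.
    have /andP[i1 i2] := truncn_itv (cge0 i k).
    have /andP[j1 j2] := truncn_itv (cge0 j k).
    move: i1 i2; rewrite tij -natr1 => i1 i2; rewrite -natr1 in j2.
    move: i1 i2 j1 j2; rewrite !ler_pdivlMr// !ltr_pdivrMr// => i1 i2 j1 j2.
    by rewrite !mxE ler_norml; apply/andP; split; lra.
  apply: (@le_lt_trans _ _ (n%:R * s)).
    apply: le_trans (enorm_le_sum _) _; apply: (@le_trans _ _ (\sum_(k < n) s)).
      exact: ler_sum.
    by rewrite sumr_const card_ord mulr_natl.
  by rewrite ltr_pM2r// ltr_nat.
have := leq_card cell cell_inj; rewrite card_ffun !card_ord => le_card.
apply: (@le_trans _ _ ((m.+1 ^ n)%:R)); first by rewrite ler_nat.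
rewrite natrX lerXn2r ?nnegrE//; first by rewrite addr_ge0// divr_ge0 ?mulr_ge0// ltW.
rewrite -natr1 lerD2r truncn_le divr_ge0 ?mulr_ge0// ltW//.
Qed.

(** Balls of radius [e / 2] around the points of an [e]-separated family in the
ball of radius [r] are disjoint and lie in the ball of radius [M].  Each of them
is a copy of the latter, scaled by [l = e / (2 M)], and so contains a scaled copy
of the whole family; [t] nested repetitions give [#|I| ^ t] points. *)
Lemma separated_iterate n (I : finType) (f : I -> 'cV[R]_n) (r e : R) (t : nat) :
  let M := r + e / 2 in let l := e / (2 * M) in
  0 <= r -> 0 < e -> (forall i, enorm (f i) <= r) -> separated e f ->
  exists (K : finType) (g : K -> 'cV[R]_n),
    [/\ #|K| = (#|I| ^ t)%N,
        forall k, enorm (g k) + M * l ^+ t <= M &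
        separated (2 * M * l ^+ t) g].
Proof.
move=> M l r0 e0 fr sep.
have M0 : 0 < M by rewrite /M; lra.
have l0 : 0 < l by rewrite /l divr_gt0// mulr_gt0.
have lM : 2 * (l * M) = e by rewrite /l; field; exact: lt0r_neq0.
have rlM : r + l * M = M by have : M = r + e / 2 by []; lra.
clearbody l M.
elim: t => [|t [K [g [cardK gM gsep]]]].
  exists unit, (fun=> 0); split; first by rewrite card_unit.
  - by move=> _; rewrite enorm0 expr0; lra.
  - by move=> [] [].
exists (I * K)%type, (fun p => f p.1 + l *: g p.2); split.
- by rewrite card_prod cardK expnS.
- move=> [i k] /=; have := enormD (f i) (l *: g k).
  rewrite enormZ (gtr0_norm l0) exprS.
  have := fr i; have := ler_wpM2l (ltW l0) (gM k).
  by rewrite mulrDr (mulrCA l M); lra.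
- move=> [i k] [i' k'] /=; have [<-{i'}|ii' _] := eqVneq i i'.
    rewrite xpair_eqE eqxx /= => /gsep h.
    rewrite opprD addrACA subrr add0r -scalerBr enormZ (gtr0_norm l0) exprS.
    by rewrite mulrCA ler_pM2l.
  have := sep _ _ ii'.
  have -> : f i - f i' = (f i + l *: g k - (f i' + l *: g k')) + (l *: g k' - l *: g k).
    by rewrite opprD (addrACA (f i)) -(opprB (l *: g k) (l *: g k')) addrK.
  move=> /le_trans/(_ (enormD _ _)).
  have := enormD (l *: g k') (- (l *: g k)).
  rewrite enormN !enormZ (gtr0_norm l0).
  have := ler_wpM2l (ltW l0) (gM k); have := ler_wpM2l (ltW l0) (gM k').
  by rewrite exprS !mulrDr; lra.
Qed.

Lemma ler_of_expr_bounded (a b C : R) :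
  0 < b -> (forall t, a ^+ t <= C * b ^+ t) -> a <= b.
Proof.
move=> b0 h; rewrite leNgt; apply/negP => ba.
pose x := a / b - 1.
have x0 : 0 < x by rewrite /x subr_gt0 ltr_pdivlMr// mul1r.
have bern t : 1 + t%:R * x <= (1 + x) ^+ t.
  elim: t => [|t IH]; first by rewrite mul0r addr0 expr0.
  rewrite exprS; apply: le_trans (ler_wpM2l _ IH); last by lra.
  have := mulr_ge0 (ler0n R t) (sqr_ge0 x); rewrite -natr1; lra.
have := bern (Num.truncn (C / x)).+1; set t := (_.+1).
have Ct : C < t%:R * x.
  by rewrite -ltr_pdivrMr//; exact: truncnS_gt.
have : (1 + x) ^+ t <= C.
  by rewrite /x addrC subrK expr_div_n ler_pdivrMr ?exprn_gt0.
by lra.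
Qed.

(** The volume bound for packings, proved without volumes.  Nesting the family
[t] times and counting with the grid gives [#|I| ^ t <= C (1 + 2 r / e) ^ (n t)]
with [C] independent of [t]; letting [t] grow removes the constant [C]. *)
Lemma separated_card n (I : finType) (f : I -> 'cV[R]_n) (r e : R) :
  0 <= r -> 0 < e -> (forall i, enorm (f i) <= r) -> separated e f ->
  #|I|%:R <= (1 + 2 * r / e) ^+ n.
Proof.
move=> r0 e0 fr sep.
have q1 : 1 <= 1 + 2 * r / e by rewrite lerDl divr_ge0 ?mulr_ge0// ltW.
apply: (@ler_of_expr_bounded _ _ (n.+2%:R ^+ n)); first by rewrite exprn_gt0//; lra.
move=> t; have [K [g [cardK gM gsep]]] := separated_iterate t r0 e0 fr sep.
set M := r + e / 2 in gM gsep; set l := e / (2 * M) in gM gsep.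
have M0 : 0 < M by rewrite /M; lra.
have l0 : 0 < l by rewrite /l divr_gt0// mulr_gt0.
have qE : 1 + 2 * r / e = l^-1.
  by rewrite /l invf_div /M; field; exact: lt0r_neq0.
have lt0 : 0 < l ^+ t by rewrite exprn_gt0.
have n0 : (0 : R) < n.+1%:R by [].
(* This cell size turns the separation of [g] into the one required by the grid. *)
pose s := 2 * M * l ^+ t / n.+1%:R.
have s0 : 0 < s by rewrite divr_gt0// !mulr_gt0.
have := @separated_card_grid n K g M s (ltW M0) s0.
rewrite cardK natrX => /(_ _ _)/le_trans; apply.
- by move=> k; apply: le_trans (gM k); rewrite lerDl mulr_ge0// ltW.
- suff -> : n.+1%:R * s = 2 * M * l ^+ t by [].
  by rewrite /s mulrC divfK// lt0r_neq0.
rewrite qE -exprM mulnC exprM -exprMn lerXn2r ?nnegrE//.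
- by rewrite addr_ge0// divr_ge0 ?mulr_ge0// ltW.
- by rewrite mulr_ge0// exprn_ge0// invr_ge0 ltW.
have -> : 2 * M / s = n.+1%:R * l^-1 ^+ t.
  by rewrite /s exprVn; field; rewrite !lt0r_neq0//=.
rewrite -[n.+2%:R]natr1 mulrDl mul1r lerD2l exprn_ege1//.
by rewrite -qE.
Qed.

(** A largest separated family in [X] is a net of [X], since a point that is far
from the whole family could be added to it. *)
Lemma exists_net n (X : set 'cV[R]_n) (r e : R) :
  X !=set0 -> 0 < e -> (forall x, X x -> enorm x <= r) ->
  exists (K : nat) (z : 'I_K.+1 -> 'cV[R]_n),
    [/\ forall i, X (z i), K.+1%:R <= (1 + 2 * r / e) ^+ n &
        forall x, X x -> exists i, enorm (x - z i) <= e].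
Proof.
move=> [x0 Xx0] e0 Xr.
have r0 : 0 <= r by exact: le_trans (enorm_ge0 x0) (Xr _ Xx0).
pose p K := `[< exists z : 'I_K.+1 -> 'cV[R]_n, (forall i, X (z i)) /\ separated e z >].
have pP K : p K -> K.+1%:R <= (1 + 2 * r / e) ^+ n.
  move=> /asboolP[z [Xz zsep]]; rewrite -[K.+1]card_ord.
  by apply: separated_card zsep => // i; exact/Xr/Xz.
have p0 : exists K, p K.
  exists 0; apply/asboolP; exists (fun=> x0); split=> // i j.
  by rewrite (ord1 i) (ord1 j) eqxx.
have pmax K : p K -> (K <= Num.truncn ((1 + 2 * r / e) ^+ n))%N.
  move=> /pP h; rewrite truncn_ge_nat; last by apply: le_trans h.
  by apply: le_trans h; rewrite ler_nat.
case: (ex_maxnP p0 pmax) => K pK Kmax; have /asboolP[z [Xz zsep]] := pK.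
exists K, z; split => //; first exact: pP.
move=> x Xx; apply/not_existsP => far.
suff /Kmax : p K.+1 by rewrite ltnn.
have {}far i : e <= enorm (x - z i) by move/negP: (far i); rewrite -ltNge => /ltW.
(* The new point takes the index [ord0], the old ones are shifted. *)
apply/asboolP; exists (fun i => oapp z x (unlift ord0 i)); split.
  by move=> i; case: unliftP => [j _|_] //=.
move=> i j; case: (unliftP ord0 i) => [i' ->|->]; case: (unliftP ord0 j) => [j' ->|->] //=.
- by rewrite (inj_eq (@lift_inj _ _)) => /zsep.
- by rewrite enormB.
Qed.

End Packing.

(** * The loss as a function of the decision and of the uncertainty *)

Section Loss.
Context {R : realType} (Dx Dxi J : nat).
Context (A : 'I_J.+1 -> 'M[R]_(Dxi, Dx)) (abar : 'I_J.+1 -> 'cV[R]_Dxi)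
  (b : 'I_J.+1 -> 'cV[R]_Dx) (bbar : 'I_J.+1 -> R).

Local Notation ell := (loss A abar b bbar).
Local Notation opA := (maxI (fun j => opnorm (A j))).
Local Notation normb := (maxI (fun j => enorm (b j))).

Lemma maxI_opnorm_ge0 : 0 <= opA.
Proof. exact: le_trans (opnorm_ge0 (A ord0)) (le_maxI _ _). Qed.

Lemma maxI_enorm_ge0 : 0 <= normb.
Proof. exact: le_trans (enorm_ge0 (b ord0)) (le_maxI (fun j => enorm (b j)) _). Qed.

Lemma loss_lipschitz x y xi :
  ell x xi <= ell y xi + (opA * enorm xi + normb) * enorm (x - y).
Proof.
apply: maxI_le => j.
have lej := le_maxI (fun j => dot (A j *m y + abar j) xi + (dot (b j) y + bbar j)) j.
have xE : x = y + (x - y) by rewrite addrC subrK.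
set h := x - y in xE *; rewrite xE mulmxDr !dotDl dotDr.
rewrite !dotDl in lej.
have bound1 : dot (A j *m h) xi <= opA * enorm h * enorm xi.
  apply: le_trans (cauchy_schwarz _ _) _; rewrite ler_wpM2r ?enorm_ge0//.
  apply: le_trans (enorm_mulmx_le_opnorm _ _) _; rewrite ler_wpM2r ?enorm_ge0//.
  exact: (le_maxI (fun j => opnorm (A j))).
have bound2 : dot (b j) h <= normb * enorm h.
  apply: le_trans (cauchy_schwarz _ _) _; rewrite ler_wpM2r ?enorm_ge0//.
  exact: (le_maxI (fun j => enorm (b j))).
rewrite -/(ell y xi) in lej; set r := ell y xi in lej *.
lra.
Qed.

(** The growth is in fact linear; the quadratic form is the one that a bound on
the second moment turns into integrability. *)
Lemma loss_quadratic_growth x :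
  exists k1 k0, [/\ 0 <= k1, 0 <= k0 &
    forall xi, `|ell x xi| <= k1 * enorm xi ^+ 2 + k0].
Proof.
pose a j := A j *m x + abar j; pose c j := dot (b j) x + bbar j.
exists (\sum_j enorm (a j)), (\sum_j (enorm (a j) + `|c j|)); split.
- by apply: sumr_ge0 => j _; exact: enorm_ge0.
- by apply: sumr_ge0 => j _; rewrite addr_ge0// enorm_ge0.
move=> xi; rewrite mulr_suml -big_split /=.
have term j : `|dot (a j) xi + c j| <= enorm (a j) * enorm xi ^+ 2 + (enorm (a j) + `|c j|).
  apply: le_trans (ler_normD _ _) _; rewrite addrA lerD2r.
  have : `|dot (a j) xi| <= enorm (a j) * enorm xi.
    rewrite ler_norml cauchy_schwarz andbT lerNl.
    by rewrite -mulN1r -dotZl scaleN1r -(enormN (a j)) cauchy_schwarz.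
  move/le_trans; apply; rewrite -[X in _ + X]mulr1 -mulrDr ler_wpM2l ?enorm_ge0//.
  by have := sqr_ge0 (enorm xi - 1); have := enorm_ge0 xi; rewrite sqrrB; lra.
have le_sum j : `|dot (a j) xi + c j| <=
    \sum_i (enorm (a i) * enorm xi ^+ 2 + (enorm (a i) + `|c i|)).
  apply: le_trans (term j) _; rewrite (bigD1 j)//= lerDl sumr_ge0// => i _.
  exact: le_trans (normr_ge0 _) (term i).
rewrite ler_norml; apply/andP; split.
  rewrite lerNl; apply: le_trans (le_sum ord0).
  rewrite lerNl; apply: le_trans (le_maxI _ ord0).
  by rewrite lerNl -normrN; exact: ler_norm.
by apply: maxI_le => j; apply: le_trans (ler_norm _) (le_sum j).
Qed.

Lemma measurable_coord n (i : 'I_n) :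
  measurable_fun setT (fun u : borel R n => (u : 'cV[R]_n) i 0).
Proof.
apply: (measurability _ (RGenOpens.measurableE R)).
move=> _ [_ [a [c ->]] <-]; rewrite setTI; apply: sub_sigma_algebra.
by move: (@coord_continuous R n 1 i 0) => /continuousP; apply; exact: interval_open.
Qed.

Lemma measurable_dot n (c : 'cV[R]_n) :
  measurable_fun setT (fun u : borel R n => dot c u).
Proof.
under eq_fun do rewrite dotE.
by apply: measurable_sum => i; apply: measurable_funM => //; exact: measurable_coord.
Qed.

Lemma measurable_enorm_sqr n :
  measurable_fun setT (fun u : borel R n => enorm (u : 'cV[R]_n) ^+ 2).
Proof.
under eq_fun do rewrite enorm_sqr dotE.
by apply: measurable_sum => i; apply: measurable_funM; exact: measurable_coord.
Qed.

Lemma measurable_loss x : measurable_fun setT (fun xi : borel R Dxi => ell x xi).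
Proof.
have mterm j : measurable_fun setT
    (fun xi : borel R Dxi => dot (A j *m x + abar j) xi + (dot (b j) x + bbar j)).
  by apply: measurable_funD => //; exact: measurable_dot.
rewrite /loss /maxI; elim: (index_enum _) => [|j s IH].
  by under eq_fun do rewrite big_nil; exact: mterm.
by under eq_fun do rewrite big_cons; exact: measurable_maxr.
Qed.

Section Expectation.
Local Open Scope ereal_scope.
Context (Q : probability (borel R Dxi) R) (Omega : R)
  (Q2 : 'E_Q[fun xi => (enorm xi ^+ 2)%R] <= Omega%:E).

Let sq (xi : borel R Dxi) := (enorm (xi : 'cV[R]_Dxi) ^+ 2)%R.

Lemma integrable_enorm_sqr : Q.-integrable setT (EFin \o sq).
Proof.
apply/integrableP; split; first by apply/measurable_EFinP; exact: measurable_enorm_sqr.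
apply: le_lt_trans (ltry Omega); move: Q2; rewrite unlock; apply: le_trans.
rewrite le_eqVlt; apply/orP; left; apply/eqP; apply: eq_integral => xi _.
by rewrite /= ger0_norm ?sqr_ge0.
Qed.

Lemma integrable_affine_sqr k1 k0 :
  Q.-integrable setT (fun xi => (k1 * sq xi + k0)%:E).
Proof.
under eq_fun do rewrite EFinD EFinM.
apply: integrableD => //; first by apply: integrableZl => //; exact: integrable_enorm_sqr.
exact: finite_measure_integrable_cst.
Qed.

Lemma integral_affine_sqr_le k1 k0 : (0 <= k1)%R ->
  \int[Q]_xi (k1 * sq xi + k0)%:E <= (k1 * Omega + k0)%:E.
Proof.
move=> k10; under eq_integral do rewrite EFinD EFinM.
rewrite integralD//; last 2 first.
- by apply: integrableZl => //; exact: integrable_enorm_sqr.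
- exact: finite_measure_integrable_cst.
rewrite integralZl//; last exact: integrable_enorm_sqr.
rewrite integral_cst//= probability_setT mule1 EFinD EFinM leeD2r//.
by rewrite lee_wpmul2l ?lee_fin//; move: Q2; rewrite unlock.
Qed.

Lemma integrable_loss x : Q.-integrable setT (fun xi => (ell x xi)%:E).
Proof.
have [k1 [k0 [k10 k00 bound]]] := loss_quadratic_growth x.
apply: le_integrable (integrable_affine_sqr k1 k0) => //.
  by apply/measurable_EFinP; exact: measurable_loss.
move=> xi _; rewrite !abse_EFin lee_fin (le_trans (bound xi))//.
exact: ler_norm.
Qed.

Lemma expectation_loss_fin_num x : 'E_Q[ell x] \is a fin_num.
Proof. by rewrite unlock; apply: integrable_fin_num => //; exact: integrable_loss. Qed.

(** The expected loss inherits the Lipschitz bound of the loss, with [enorm xi]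
replaced by [Num.sqrt Omega].  Bounding [enorm xi] pointwise by
[(enorm xi ^+ 2 / s + s) / 2], with [s = Num.sqrt Omega], gives this without
Jensen's inequality. *)
Lemma expectation_loss_lipschitz x y : (0 < Omega)%R ->
  'E_Q[ell x] <= 'E_Q[ell y] +
    ((opA * Num.sqrt Omega + normb) * enorm (x - y))%:E.
Proof.
move=> Omega0; set s := Num.sqrt Omega.
have s0 : (0 < s)%R by rewrite sqrtr_gt0.
have Omega_sqr : (s ^+ 2 = Omega)%R by rewrite sqr_sqrtr// ltW.
pose h := enorm (x - y).
pose k1 := (opA * h / (2 * s))%R; pose k0 := ((opA * s / 2 + normb) * h)%R.
have k10 : (0 <= k1)%R.
  by rewrite /k1 divr_ge0 ?mulr_ge0 ?enorm_ge0 ?maxI_opnorm_ge0 ?ltW.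
have -> : ((opA * s + normb) * h = k1 * Omega + k0)%R.
  by rewrite /k1 /k0 -Omega_sqr; field; exact: lt0r_neq0.
apply: le_trans (leeD2l _ (integral_affine_sqr_le k0 k10)).
rewrite unlock -integralD//; last 2 first.
- exact: integrable_loss.
- exact: integrable_affine_sqr.
apply: le_integral => //; first exact: integrable_loss.
  by apply: integrableD => //; [exact: integrable_loss|exact: integrable_affine_sqr].
move=> xi _; rewrite -EFinD lee_fin; apply: le_trans (loss_lipschitz x y xi) _.
rewrite -/h lerD2l /k1 /k0 /sq; set t := enorm xi.
have amgm : (t <= t ^+ 2 / (2 * s) + s / 2)%R.
  rewrite -subr_ge0; have -> : (t ^+ 2 / (2 * s) + s / 2 - t = (t - s) ^+ 2 / (2 * s))%R.
    by field; exact: lt0r_neq0.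
  by rewrite divr_ge0 ?sqr_ge0// mulr_ge0// ltW.
have ah : (0 <= opA * h)%R by rewrite mulr_ge0 ?enorm_ge0 ?maxI_opnorm_ge0.
have := ler_wpM2l ah amgm.
have -> : ((opA * t + normb) * h = opA * h * t + normb * h)%R by ring.
have -> : (opA * h / (2 * s) * t ^+ 2 + (opA * s / 2 + normb) * h =
   opA * h * (t ^+ 2 / (2 * s) + s / 2) + normb * h)%R.
  by field; exact: lt0r_neq0.
by rewrite lerD2r.
Qed.

End Expectation.

End Loss.

(** * From the net to a uniform bound *)

Lemma union_bound d (T : measurableType d) (R : realType) (P : probability T R)
    (K : nat) (E : 'I_K.+1 -> set T) (delta : R) :
  (forall i, with_probability_at_least P (1 - delta / K.+1%:R) (E i)) ->
  with_probability_at_least P (1 - delta) [set w | forall i, E i w].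
Proof.
move=> hE; have [B BE] := choice hE.
pose F k := ~` B (inord k).
have mF k : measurable (F k) by apply: measurableC; have [] := BE (inord k).
pose U := \big[setU/set0]_(i < K.+1) F i.
have mU : measurable U by apply: bigsetU_measurable => i _; exact: mF.
have PU : (P U <= delta%:E)%E.
  apply: le_trans (Boole_inequality P (fun i _ => mF i)) _.
  apply: (@le_trans _ _ (\sum_(i < K.+1) (delta / K.+1%:R)%:E)%E).
    apply: lee_sum => i _; have [mB _ PB] := BE (inord i).
    rewrite -[leLHS]/(P (~` B (inord i))) probability_setC//; move: PB.
    rewrite -(fineK (fin_num_measure P _ mB)) -[1%E]/(1%:E) -EFinN -EFinD !lee_fin.
    by rewrite !lerBlDr addrC.
  by rewrite sumEFin sumr_const card_ord lee_fin -[leLHS]mulr_natr divfK.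
exists (~` U); split; first exact: measurableC.
- move=> w /= nU i; have [_ BEi _] := BE i; apply: BEi; apply: contrapT => nB.
  by apply: nU; rewrite /U -bigcup_mkord; exists i => //=; rewrite /F inord_val.
- by rewrite probability_setC// EFinB leeB.
Qed.

(** The net at scale [1 / (L * k)], in a form that makes sense for [L = 0] as well:
a single point then serves, and the logarithm of the bound is [0]. *)
Lemma exists_lipschitz_net (R : realType) n (X : set 'cV[R]_n) (r L k : R) :
  X !=set0 -> 0 <= L -> 0 < k -> (forall x, X x -> enorm x <= r) ->
  exists (K : nat) (z : 'I_K.+1 -> 'cV[R]_n),
    [/\ forall i, X (z i), ln K.+1%:R <= n%:R * ln (1 + 2 * r * L * k) &
        forall x, X x -> exists i, L * enorm (x - z i) <= k^-1].
Proof.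
move=> X0; rewrite le_eqVlt => /predU1P[<- k0 Xr|L0 k0 Xr].
  have [x0 Xx0] := X0; exists 0, (fun=> x0); split => //.
    by rewrite mulr0 mul0r addr0 ln1 mulr0.
  by move=> x _; exists ord0; rewrite mul0r invr_ge0 ltW.
have Lk0 : 0 < (L * k)^-1 by rewrite invr_gt0 mulr_gt0.
have r0 : 0 <= r by have [x0 Xx0] := X0; exact: le_trans (enorm_ge0 x0) (Xr _ Xx0).
have [K [z [Xz cardK cover]]] := exists_net X0 Lk0 Xr.
exists K, z; split => //.
  rewrite -ln_powR powR_mulrn; last by rewrite addr_ge0// !mulr_ge0// ltW.
  rewrite ler_ln ?posrE//; last by rewrite exprn_gt0// ltr_wpDr// !mulr_ge0// ltW.
  by rewrite invrK mulrA in cardK.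
move=> x /cover[i hi]; exists i.
by rewrite -ler_pdivlMl// -invfM.
Qed.

Section Reliability.
Context {R : realType} (Dx Dxi : nat).
Local Open Scope ereal_scope.

(** A uniform bound [e] makes the integrand of the first constraint vanish on
[X], so [Pstar] belongs to the ambiguity set and competes in the worst case. *)
Lemma expectation_le_worst_case (X : set 'cV[R]_Dx) (Xi : set 'cV[R]_Dxi)
    (ell : 'cV[R]_Dx -> 'cV[R]_Dxi -> R) (Z : probability (borel R Dx) R)
    (Omega e : R) (Pstar Phat : probability (borel R Dxi) R) (x : 'cV[R]_Dx) :
  distribution_on Xi Pstar ->
  'E_Pstar[fun xi => (enorm xi ^+ 2)%R] <= Omega%:E ->
  (forall z, X z -> 'E_Pstar[ell z] - 'E_Phat[ell z] <= e%:E) ->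
  'E_Pstar[ell x] <= worst_case ell (ambiguity_set X Xi ell Z Omega Phat e) x.
Proof.
move=> PXi P2 gap; apply: ereal_sup_ubound; exists Pstar => //; split => //.
rewrite integral0_eq// => z Xz.
by apply/max_idPr; rewrite leeBlDr// add0e; exact: gap.
Qed.

(** Passing from [z] to [x] costs [L * enorm (x - z)] for each of the two
expectations; this is the source of the summand [2] in the radius. *)
Lemma gap_of_nearby_gap J (A : 'I_J.+1 -> 'M[R]_(Dxi, Dx)) abar b bbar
    (Omega g h : R) (Pstar Phat : probability (borel R Dxi) R) (x z : 'cV[R]_Dx) :
  let ell := loss A abar b bbar in
  let L := (maxI (fun j => opnorm (A j)) * Num.sqrt Omega
           + maxI (fun j => enorm (b j)))%R in
  (0 < Omega)%R ->
  'E_Pstar[fun xi => (enorm xi ^+ 2)%R] <= Omega%:E ->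
  'E_Phat[fun xi => (enorm xi ^+ 2)%R] <= Omega%:E ->
  'E_Pstar[ell z] - 'E_Phat[ell z] <= g%:E -> (L * enorm (x - z) <= h)%R ->
  'E_Pstar[ell x] - 'E_Phat[ell x] <= (g + 2 * h)%:E.
Proof.
move=> ell L Omega0 Ps2 Ph2 gap near.
have := expectation_loss_lipschitz A abar b bbar Ps2 x z Omega0.
have := expectation_loss_lipschitz A abar b bbar Ph2 z x Omega0.
rewrite -/ell -/L enormB => le1 le2; move: gap le1 le2.
have fs y : 'E_Pstar[ell y] \is a fin_num by exact: expectation_loss_fin_num Ps2 _.
have fh y : 'E_Phat[ell y] \is a fin_num by exact: expectation_loss_fin_num Ph2 _.
rewrite -(fineK (fs x)) -(fineK (fs z)) -(fineK (fh x)) -(fineK (fh z)).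
by rewrite -!EFinD !lee_fin; lra.
Qed.

End Reliability.

Theorem corollary1 (R : realType) (Dx Dxi J N : nat)
  (X : set 'cV[R]_Dx) (Xi : set (borel R Dxi))
  (A : 'I_J.+1 -> 'M[R]_(Dxi, Dx)) (abar : 'I_J.+1 -> 'cV[R]_Dxi)
  (b : 'I_J.+1 -> 'cV[R]_Dx) (bbar : 'I_J.+1 -> R)
  (c1 c2 Rx Omega : R)
  (Pstar : probability (borel R Dxi) R)
  (Z : probability (borel R Dx) R)
  (d : measure_display) (T : measurableType d) (P : probability T R)
  (data : 'I_N -> {RV P >-> borel R Dxi})
  (reference : ('I_N -> 'cV[R]_Dxi) -> probability (borel R Dxi) R)
  (eps : R -> R) (delta : R) (xhat : T -> 'cV[R]_Dx) :
  let ell := loss A abar b bbar in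
  let Phat := fun w : T => reference (fun i => data i w) in
  let L := maxI (fun j => opnorm (A j)) * Num.sqrt Omega
           + maxI (fun j => enorm (b j)) in
  let e := (Num.sqrt N%:R)^-1 *
     (eps (Dx%:R * ln (1 + 2 * Rx * L * Num.sqrt N%:R) + ln (delta^-1)) + 2) in
  let worst := fun w : T =>
     worst_case ell (ambiguity_set X Xi ell Z Omega (Phat w) e) in
  let Jhat := fun w : T => ereal_inf [set worst w x | x in X] in
  (0 < N)%N ->
  compact X -> convex_set X ->
  (forall x, X x -> enorm x <= Rx) ->
  measurable Xi ->
  0 <= c1 -> 0 <= c2 ->
  (forall x xi, X x -> Xi xi -> `|ell x xi| <= c1 + c2 * enorm xi) ->
  distribution_on Xi Pstar ->
  ('E_Pstar[fun xi => (enorm xi ^+ 2)%R] <= Omega%:E)%E ->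
  (forall w, distribution_on Xi (Phat w)) ->
  (forall w, ('E_(Phat w)[fun xi => (enorm xi ^+ 2)%R] < Omega%:E)%E) ->
  full_support_on X Z ->
  (forall t, 0 <= t -> 0 <= eps t) ->
  (forall s t, 0 <= s -> s <= t -> eps s <= eps t) ->
  (exists (C : R) (k : nat), \forall t \near +oo, eps t <= C * t ^+ k) ->
  (forall z, X z -> forall delta' : R, 0 < delta' < 1 ->
     with_probability_at_least P (1 - delta')
       [set w | ('E_Pstar[ell z] - 'E_(Phat w)[ell z]
                 <= ((Num.sqrt N%:R)^-1 * eps (ln (delta'^-1)))%:E)%E]) ->
  0 < delta < 1 ->
  (forall w, is_minimizer X (worst w) (xhat w)) ->
  with_probability_at_least P (1 - delta)
    [set w | ('E_Pstar[ell (xhat w)] <= Jhat w)%E].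
Proof.
move=> ell Phat L e worst Jhat N0 _ _ XRx _ _ _ _ PsXi Ps2 _ Ph2 [ZX _].
move=> _ eps_mono _ conc /andP[d0 d1] xmin.
have X0 : X !=set0.
  apply/set0P/negP => /eqP X0; move: ZX; rewrite /distribution_on X0 measure0.
  by move/eqP; rewrite eqe eq_sym oner_eq0.
have [w0 _] : [set: T] !=set0.
  apply/set0P/negP => /eqP T0; have := probability_setT P; rewrite T0 measure0.
  by move/eqP; rewrite eqe eq_sym oner_eq0.
(* The strict moment bound on the reference distribution makes [Omega] positive. *)
have Omega0 : 0 < Omega.
  rewrite -lte_fin; apply: le_lt_trans (Ph2 w0); apply: expectation_ge0 => xi.
  exact: sqr_ge0.
have k0 : 0 < Num.sqrt (N%:R : R) by rewrite sqrtr_gt0 ltr0n.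
have L0 : 0 <= L.
  by rewrite addr_ge0 ?mulr_ge0 ?sqrtr_ge0 ?maxI_opnorm_ge0 ?maxI_enorm_ge0.
have [K [z [Xz cardK cover]]] := exists_lipschitz_net X0 L0 k0 XRx.
have K0 : (0 : R) < K.+1%:R by [].
have dK : 0 < delta / K.+1%:R < 1.
  by rewrite divr_gt0//= ltr_pdivrMr// mul1r (lt_le_trans d1) ?ler1n.
have [B [mB Bgap PB]] := union_bound (fun i => conc (z i) (Xz i) _ dK).
exists B; split => // w /Bgap /= gap; rewrite /Jhat.
have [_ hmin] := xmin w.
suff h : ('E_Pstar[ell (xhat w)] <= worst w (xhat w))%E.
  by apply: le_trans h _; apply: le_ereal_inf_tmp => _ [x Xx <-]; exact: hmin.
apply: expectation_le_worst_case => // x Xx.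
have [i near] := cover x Xx.
have := gap_of_nearby_gap Omega0 Ps2 (ltW (Ph2 w)) (gap i) near.
move/le_trans; apply; rewrite lee_fin /e mulrDr [_ * 2]mulrC lerD2r.
rewrite ler_wpM2l ?invr_ge0 ?(ltW k0)//; apply: eps_mono.
  by rewrite ln_ge0// invf_ge1; case/andP: dK => // ? /ltW.
by rewrite invf_div lnM ?posrE ?invr_gt0// lerD2r.
Qed.
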